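(* Let $q\in(0,1)$. For $\alpha,\gamma\in\mathbb{C}$ and $\beta\in[-1,1]$ let $\mathcal{G}^{(q,1A)}$, $\mathcal{G}_\alpha^{(q,1B)}$ and $\mathcal{G}_{\alpha,\beta,\gamma}^{(q,1C)}$ be the quantum graphs on $(M_2,\psi_q)$ with $q$-adjusted Pauli spaces $$V^{(q,1A)}=\mathrm{span}\{e_1\},\quad V_\alpha^{(q,1B)}=\mathrm{span}\{(\alpha,0,0,1)^t\},\quad V_{\alpha,\beta,\gamma}^{(q,1C)}=\mathrm{span}\{(\alpha,1,i\beta,\gamma)^t\}$$ in $\mathbb{C}^4$, respectively. Let $J^{(q,1C)}$ be the set of triples $(\alpha,\beta,\gamma)\in\mathbb{C}\times[-1,1]\times\mathbb{C}$ such that $$\begin{aligned}\beta=\pm1,\ \alpha\ne0&\implies\alpha\in(0,\infty),\\ \beta=\pm1,\ \alpha=0&\implies\gamma\in[0,\infty),\\ \beta\in(-1,1),\ \alpha\ne0&\implies\arg(\alpha)\in[0,\pi),\\ \beta\in(-1,1),\ \alpha=0&\implies\arg(\gamma)\in[0,\pi).\end{aligned}$$ Then every quantum graph on $(M_2,\psi_q)$ with exactly one quantum edge is either the trivial quantum graph $\mathcal{G}^{(q,1A)}$ (with quantum edge space $\mathbb{C}\mathrm{I}_2$) or isomorphic to exactly one of the quantum graphs $\mathcal{G}_\alpha^{(q,1B)}$, $\mathcal{G}_{\alpha,\beta,\gamma}^{(q,1C)}$, where $\alpha\in\mathbb{C}$ and $(\alpha,\beta,\gamma)\in J^{(q,1C)}$,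 respectively.
   Context: Let $\rho_q=(1+q^2)\,\mathrm{diag}(q^{-2},1)$ and $\psi_q=\mathrm{Tr}(\rho_q\,\cdot)$ on $M_2$. A quantum graph on $(M_2,\psi_q)$ is given by its quantum edge space, an arbitrary linear subspace $S\subset M_2$; the number of quantum edges is $\dim S$. Two quantum graphs on $(M_2,\psi_q)$ with edge spaces $S_1,S_2$ are isomorphic if there is a $*$-automorphism $\pi$ of $M_2$ with $\psi_q\circ\pi=\psi_q$ and $\pi(S_1)=S_2$. Let $\sigma_0=\mathrm{I}_2$, $\sigma_1=\begin{pmatrix}0&1\\1&0\end{pmatrix}$, $\sigma_2=\begin{pmatrix}0&-i\\i&0\end{pmatrix}$ and $\sigma_3^{(q)}=\begin{pmatrix}q^{-2}&0\\0&-1\end{pmatrix}$. The $q$-adjusted Pauli space of the quantum graph with edge space $S$ is $V^{(q)}=\{(x_0,x_1,x_2,x_3)^t\in\mathbb{C}^4: x_0\sigma_0+x_1\sigma_1+x_2\sigma_2+x_3\sigma_3^{(q)}\in S\}$. Convention: $\arg(0)=0$, and $\arg$ takes values in $[0,2\pi)$. *)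

(* Defs.v *)
From HB Require Import structures.
From mathcomp Require Import all_boot all_order all_algebra.
From mathcomp Require Import complex.
From mathcomp Require Import reals trigo.

Set Implicit Arguments.
Unset Strict Implicit.
Unset Printing Implicit Defensive.

Import Order.TTheory GRing.Theory Num.Theory.
Local Open Scope ring_scope.
Local Open Scope complex_scope.
Local Open Scope sesquilinear_scope.

(* The argument of a complex number, in [0, 2 pi[, with carg 0 = 0;
   see carg_itv and carg_polar. *)
Definition carg (R : realType) (z : R[i]) : R :=
  if z == 0 then 0 else
  let t := acos (complex.Re z / Normc.normc z) in
  if 0 <= complex.Im z then t else pi *+ 2 - t.

Fact carg_cos_bound (R : realType) (z : R[i]) :
  -1 <= complex.Re z / Normc.normc z <= 1.
Proof.
have n0 : 0 <= Normc.normc z by case: z => a b; exact: sqrtr_ge0.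
have le_n : `|complex.Re z| <= Normc.normc z.
  by case: z {n0} => a b /=; rewrite -sqrtr_sqr ler_wsqrtr // lerDl sqr_ge0.
have [->|nN0] := eqVneq (Normc.normc z) 0.
  by rewrite invr0 mulr0 lerN10 ler01.
have np : 0 < Normc.normc z by rewrite lt_def nN0.
by rewrite -ler_norml normrM normfV (gtr0_norm np) ler_pdivrMr // mul1r.
Qed.

Lemma carg_itv (R : realType) (z : R[i]) : 0 <= carg z < pi *+ 2.
Proof.
rewrite /carg; case: eqP => [_|_]; first by rewrite lexx mulrn_wgt0 // pi_gt0.
have b := carg_cos_bound z; have := acos_ge0 b; have := acos_lepi b.
set t := acos _ => tpi t0; have p0 : 0 < pi :> R by exact: pi_gt0.
case: ifP => [_|imN]; first by rewrite t0 (le_lt_trans tpi) // mulr2n ltrDl.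
rewrite subr_ge0 (le_trans tpi) ?mulr2n ?lerDl ?(ltW p0) //= gtrBl acos_gt0 //.
case/andP: b => -> b1 /=; rewrite lt_neqAle b1 andbT.
case: z imN {t tpi t0 b1} => x y /= /negbT; rewrite -ltNge => y0.
have s0 : 0 < x ^+ 2 + y ^+ 2.
  by rewrite ltr_wpDl ?sqr_ge0 // exprn_even_gt0 //= lt_eqF.
apply/eqP => /(canRL (divfK (lt0r_neq0 _))); rewrite sqrtr_gt0 => /(_ s0).
rewrite mul1r => /(congr1 (fun u => u ^+ 2)); rewrite sqr_sqrtr ?ltW // => /eqP.
by rewrite -subr_eq0 opprD addNKr oppr_eq0 sqrf_eq0 lt_eqF.
Qed.

Lemma carg_polar (R : realType) (z : R[i]) :
  z = (Normc.normc z)%:C * (cos (carg z) +i* sin (carg z)).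
Proof.
have [->|zN0] := eqVneq z 0; first by rewrite Normc.normc0 mul0r.
have b := carg_cos_bound z; rewrite /carg (negbTE zN0).
set t := acos _.
have ct : cos t = complex.Re z / Normc.normc z by rewrite acosK.
have st : sin t = `|complex.Im z| / Normc.normc z.
  rewrite sin_acos //; case: z zN0 {b t ct} => x y zN0 /=.
  have s0 : 0 < x ^+ 2 + y ^+ 2.
    rewrite lt_def addr_ge0 ?sqr_ge0 // andbT paddr_eq0 ?sqr_ge0 //.
    by rewrite !sqrf_eq0; move: zN0; rewrite eq_complex.
  have -> : 1 - (x / Num.sqrt (x ^+ 2 + y ^+ 2)) ^+ 2 =
            (y / Num.sqrt (x ^+ 2 + y ^+ 2)) ^+ 2.
    rewrite !expr_div_n sqr_sqrtr ?ltW //.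
    rewrite -{1}(divff (lt0r_neq0 s0)) -mulrBl addrAC subrr add0r //.
  by rewrite sqrtr_sqr normrM normfV (ger0_norm (sqrtr_ge0 _)).
have nN0 : Normc.normc z != 0.
  by apply: contra zN0 => /eqP /Normc.eq0_normc ->.
have [cE sE] :
    cos (if 0 <= complex.Im z then t else pi *+ 2 - t) = cos t /\
    sin (if 0 <= complex.Im z then t else pi *+ 2 - t) =
    complex.Im z / Normc.normc z.
  case: ifP => [y0|/negbT]; first by rewrite st ger0_norm.
  rewrite -ltNge => y0; rewrite addrC cosD2pi sinD2pi cosN sinN st.
  by rewrite ltr0_norm // mulNr opprK.
rewrite cE sE ct; apply/eqP; rewrite eq_complex /= !mul0r subr0 addr0.
by rewrite ![Normc.normc z * _]mulrC !divfK // !eqxx.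
Qed.

Definition mx22 (T : nzRingType) (a b c d : T) : 'M[T]_2 :=
  \matrix_(i < 2, j < 2) (nth [::] [:: [:: a; b]; [:: c; d]] i)`_j.

Definition cV4 (T : nzRingType) (a b c d : T) : 'cV[T]_4 :=
  \col_(i < 4) [:: a; b; c; d]`_i.

Definition rho (R : realType) (q : R) : 'M[R[i]]_2 :=
  (1 + q ^+ 2)%:C *: mx22 (q ^- 2)%:C 0 0 1.

Definition psi (R : realType) (q : R) (A : 'M[R[i]]_2) : R[i] :=
  \tr (rho q *m A).

(* A quantum graph on (M_2, psi q) is given by its quantum edge space. *)
Definition qgraph (R : realType) := {vspace 'M[R[i]]_2}.

Definition num_qedges (R : realType) (S : qgraph R) : nat := \dim S.

(* M ^t* is the conjugate transpose of M. *)
Definition star_automorphism (R : realType) (f : 'End('M[R[i]]_2)) : Prop :=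
  [/\ bijective f,
      forall A B, f (A *m B) = f A *m f B &
      forall A, f (A ^t*) = (f A) ^t*].

Definition qgraph_iso (R : realType) (q : R) (S1 S2 : qgraph R) : Prop :=
  exists f : 'End('M[R[i]]_2),
    [/\ star_automorphism f,
        forall A, psi q (f A) = psi q A &
        (f @: S1)%VS = S2].

Definition pauli (R : realType) (q : R) (k : 'I_4) : 'M[R[i]]_2 :=
  [:: 1%:M; mx22 0 1 1 0; mx22 0 (- 'i) 'i 0; mx22 (q ^- 2)%:C 0 0 (-1)]`_k.

Definition pauli_comb (R : realType) (q : R) (x : 'cV[R[i]]_4) : 'M[R[i]]_2 :=
  \sum_(k < 4) x k 0 *: pauli q k.

Fact pauli_comb_linear (R : realType) (q : R) : linear (@pauli_comb R q).
Proof.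
move=> a x y; rewrite /pauli_comb scaler_sumr -big_split /=.
by apply: eq_bigr => k _; rewrite !mxE scalerDl scalerA.
Qed.

HB.instance Definition _ (R : realType) (q : R) :=
  GRing.isLinear.Build R[i] 'cV[R[i]]_4 'M[R[i]]_2 _ (@pauli_comb R q)
    (@pauli_comb_linear R q).

Definition pauli_space (R : realType) (q : R) (S : qgraph R) :
  {vspace 'cV[R[i]]_4} := (linfun (pauli_comb q) @^-1: S)%VS.

(* The quantum graph whose q-adjusted Pauli space is V: existence and
   uniqueness are pauli_spaceK and qgraph_of_pauliK. *)
Definition qgraph_of_pauli (R : realType) (q : R) (V : {vspace 'cV[R[i]]_4}) :
  qgraph R := (linfun (pauli_comb q) @: V)%VS.

Lemma mem_pauli_space (R : realType) (q : R) (S : qgraph R) x :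
  (x \in pauli_space q S) = (pauli_comb q x \in S).
Proof. by rewrite -memv_preim lfunE. Qed.

Lemma pauli_comb_inj (R : realType) (q : R) : injective (@pauli_comb R q).
Proof.
move=> x y /eqP; rewrite -subr_eq0 -raddfB /= => /eqP.
move: (x - y) (subr_eq0 x y) => z zE cz0; apply/eqP; rewrite -zE.
have E i j : pauli_comb q z i j = 0 by rewrite cz0 mxE.
have := E 0 0; have := E 0 1; have := E 1 0; have := E 1 1.
rewrite /pauli_comb !summxE !big_ord_recl !big_ord0 /= !mxE /= ?mxE /=.
rewrite !(mulr1, mulr0, add0r, addr0, mulrN) => e11 e10 e01 e00.
set z0 := z _ _ in e11 e00; set z3 := z _ _ in e11 e00.
set z1 := z _ _ in e10 e01; set z2 := z _ _ in e10 e01.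
have z30 : z3 = 0.
  have : z3 * (1 + q ^- 2)%:C = 0.
    rewrite rmorphD rmorph1 mulrDr mulr1.
    have -> : z3 = z0 by apply/esym/eqP; rewrite -subr_eq0 e11.
    by have z03 : z0 = z3 by [apply/eqP; rewrite -subr_eq0 e11];
       rewrite {2}z03 e00.
  move/eqP; rewrite mulf_eq0 => /orP[/eqP //|].
  have : 0 < 1 + q ^- 2 by rewrite ltr_pwDl // invr_ge0 sqr_ge0.
  by rewrite eq_complex /= => /gt_eqF ->.
have z00 : z0 = 0 by move: e11; rewrite z30 subr0.
have z10 : z1 = 0.
  have : z1 *+ 2 = 0.
    by rewrite mulr2n -{1}(addrK (z2 * 'i) z1) e10 sub0r addrC e01.
  by move/eqP; rewrite mulrn_eq0 => /eqP.
have z20 : z2 = 0.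
  move/eqP: e10; rewrite z10 add0r mulf_eq0 => /orP[/eqP //|].
  by rewrite eq_complex /= oner_eq0 andbF.
apply/eqP/matrixP => i j; rewrite mxE ord1 -[RHS]/0.
case: i => [[|[|[|[|//]]]] ?].
- by rewrite -[RHS]z00; congr (z _ _); apply/val_inj.
- by rewrite -[RHS]z10; congr (z _ _); apply/val_inj.
- by rewrite -[RHS]z20; congr (z _ _); apply/val_inj.
- by rewrite -[RHS]z30; congr (z _ _); apply/val_inj.
Qed.

Lemma lker_pauli (R : realType) (q : R) : lker (linfun (@pauli_comb R q)) = 0%VS.
Proof.
by apply/eqP/lker0P => x y; rewrite !lfunE; apply: pauli_comb_inj.
Qed.

Lemma pauli_spaceK (R : realType) (q : R) (V : {vspace 'cV[R[i]]_4}) :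
  pauli_space q (qgraph_of_pauli q V) = V.
Proof.
apply/vspaceP => x; rewrite mem_pauli_space; apply/idP/idP => [|xV].
  by case/memv_imgP => y yV; rewrite lfunE => /pauli_comb_inj ->.
by apply/memv_imgP; exists x => //; rewrite lfunE.
Qed.

Lemma qgraph_of_pauliK (R : realType) (q : R) (S : qgraph R) :
  qgraph_of_pauli q (pauli_space q S) = S.
Proof.
have imT : limg (linfun (@pauli_comb R q)) == fullv.
  by rewrite eqEdim subvf /= limg_dim_eq ?lker_pauli ?capv0 // !dimvf.
by apply: lpreimK; rewrite (eqP imT) subvf.
Qed.

Definition G1A (R : realType) (q : R) : qgraph R :=
  qgraph_of_pauli q <[cV4 1 0 0 0]>.

Definition G1B (R : realType) (q : R) (alpha : R[i]) : qgraph R :=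
  qgraph_of_pauli q <[cV4 alpha 0 0 1]>.

Definition G1C (R : realType) (q : R) (alpha : R[i]) (beta : R)
    (gamma : R[i]) : qgraph R :=
  qgraph_of_pauli q <[cV4 alpha 1 ('i * beta%:C) gamma]>.

(* On R[i], 0 < z (resp. 0 <= z) means that z is real and positive
   (resp. nonnegative). *)
Definition J1C (R : realType) (alpha : R[i]) (beta : R) (gamma : R[i]) : Prop :=
  -1 <= beta <= 1 /\
  [/\ (beta = 1 \/ beta = -1) -> alpha <> 0 -> 0 < alpha,
      (beta = 1 \/ beta = -1) -> alpha = 0 -> 0 <= gamma,
      -1 < beta < 1 -> alpha <> 0 -> 0 <= carg alpha < pi &
      -1 < beta < 1 -> alpha = 0 -> 0 <= carg gamma < pi].

Inductive one_edge_index (R : realType) : Type :=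
| Idx1B (alpha : R[i])
| Idx1C (alpha : R[i]) (beta : R) (gamma : R[i]).

Definition one_edge_admissible (R : realType) (p : one_edge_index R) : Prop :=
  match p with
  | Idx1B _ => True
  | Idx1C alpha beta gamma => J1C alpha beta gamma
  end.

Definition one_edge_graph (R : realType) (q : R) (p : one_edge_index R) :
  qgraph R :=
  match p with
  | Idx1B alpha => G1B q alpha
  | Idx1C alpha beta gamma => G1C q alpha beta gamma
  end.

(* Main.v *)
(* The psi_q-preserving *-automorphisms of M_2 are exactly the maps fixing the
   diagonal and multiplying the off-diagonal entries by w and by its conjugate,
   for a phase w.  Two lines of M_2 are therefore isomorphic iff their spanning
   matrices agree up to such a w and a nonzero scalar k.  When the off-diagonal
   entries (s, t) are not both zero, k and w can be chosen to make them
   nonnegative with sum 2, that is (1 + beta, 1 - beta); this leaves only k = -1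
   if both are nonzero, and an arbitrary phase k if beta = 1 or beta = -1.  The
   conditions defining J^(q,1C) select one point in each orbit of this residual
   action on (alpha, gamma). *)
Require Import Defs.
From HB Require Import structures.
From mathcomp Require Import all_boot all_order all_algebra.
From mathcomp Require Import complex.
From mathcomp Require Import reals trigo.
From mathcomp Require Import ring lra.

Import Order.TTheory GRing.Theory Num.Theory.
Local Open Scope complex_scope.
Local Open Scope ring_scope.

(** * Entrywise calculus of 2x2 matrices *)

Lemma mx22_eta {T : nzRingType} (A : 'M[T]_2) :
  A = mx22 (A 0 0) (A 0 1) (A 1 0) (A 1 1).
Proof.
apply/matrixP => i j; rewrite mxE.
by case: i j => [[|[|[]]] //= ?] [[|[|[]]] //= ?]; congr (A _ _); exact/val_inj.
Qed.

Lemma mx22_inj {T : nzRingType} (a b c d a' b' c' d' : T) :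
  mx22 a b c d = mx22 a' b' c' d' -> [/\ a = a', b = b', c = c' & d = d'].
Proof.
move=> /matrixP e.
by split; [move: (e 0 0)|move: (e 0 1)|move: (e 1 0)|move: (e 1 1)]; rewrite !mxE.
Qed.

Lemma mulmx22 {T : nzRingType} (a b c d a' b' c' d' : T) :
  mx22 a b c d *m mx22 a' b' c' d' =
  mx22 (a * a' + b * c') (a * b' + b * d') (c * a' + d * c') (c * b' + d * d').
Proof. by rewrite [LHS]mx22_eta !mxE !big_ord_recl !big_ord0 /= !mxE /= !addr0. Qed.

Lemma scale_mx22 {T : nzRingType} (k a b c d : T) :
  k *: mx22 a b c d = mx22 (k * a) (k * b) (k * c) (k * d).
Proof. by rewrite [LHS]mx22_eta !mxE. Qed.

Lemma add_mx22 {T : nzRingType} (a b c d a' b' c' d' : T) :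
  mx22 a b c d + mx22 a' b' c' d' = mx22 (a + a') (b + b') (c + c') (d + d').
Proof. by rewrite [LHS]mx22_eta !mxE. Qed.

Lemma mx22_id {T : nzRingType} : 1%:M = mx22 1 0 0 1 :> 'M[T]_2.
Proof. by rewrite [LHS]mx22_eta !mxE. Qed.

Section OneEdge.
Context {R : realType}.
Notation C := R[i].
Implicit Types (A B : 'M[C]_2) (w k a s t g u z : C).

(** * Diagonal unitary conjugations *)

Definition mxadj A : 'M[C]_2 := map_mx Num.conj A^T.

Lemma mxadj22 (a b c d : C) :
  mxadj (mx22 a b c d) = mx22 (Num.conj a) (Num.conj c) (Num.conj b) (Num.conj d).
Proof. by rewrite [LHS]mx22_eta !mxE. Qed.

Lemma psi22 (q : R) (a b c d : C) :
  psi q (mx22 a b c d) = (1 + q ^+ 2)%:C * ((q ^- 2)%:C * a + d).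
Proof.
rewrite /psi /rho scale_mx22 mulmx22 /mxtrace !big_ord_recl big_ord0 !mxE /=.
by rewrite !mulr0 !mul0r !addr0 add0r mulr1 mulrDr mulrA.
Qed.

(** For [w] of modulus one this is conjugation by the unitary diag(w, 1), which commutes with
    [rho q]. *)
Definition phase_twist w A : 'M[C]_2 :=
  mx22 (A 0 0) (w * A 0 1) (Num.conj w * A 1 0) (A 1 1).

Lemma phase_twist_linear w : linear (phase_twist w).
Proof.
move=> k A B; rewrite /phase_twist scale_mx22 add_mx22 !mxE.
by congr mx22; ring.
Qed.

HB.instance Definition _ w :=
  GRing.isLinear.Build C 'M[C]_2 'M[C]_2 _ (phase_twist w) (phase_twist_linear w).

Lemma phase_twist22 w (a b c d : C) :
  phase_twist w (mx22 a b c d) = mx22 a (w * b) (Num.conj w * c) d.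
Proof. by rewrite /phase_twist !mxE. Qed.

Lemma phase_twistK w : w * Num.conj w = 1 ->
  cancel (phase_twist w) (phase_twist (Num.conj w)).
Proof.
move=> w1 A; rewrite {2}[A]mx22_eta /phase_twist !mxE /= conjCK !mulrA.
by rewrite w1 mulrC [Num.conj w * w]mulrC w1 !mulr1 !mul1r.
Qed.

Lemma phase_twist_star w : w * Num.conj w = 1 ->
  star_automorphism (linfun (phase_twist w)).
Proof.
move=> w1; split.
- exists (phase_twist (Num.conj w)) => A; rewrite lfunE /= ?phase_twistK //.
  rewrite -{1}[w]conjCK phase_twistK //.
  by rewrite conjCK mulrC.
- move=> A B; rewrite !lfunE /= [A]mx22_eta [B]mx22_eta.
  rewrite mulmx22 !phase_twist22 mulmx22; congr mx22; first 2 last.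
  + by ring.
  + by rewrite mulrACA (mulrC (Num.conj w)) w1 mul1r.
  + by rewrite mulrACA w1 mul1r.
  + by ring.
- move=> A; rewrite !lfunE /= [A]mx22_eta -!/(mxadj _).
  by rewrite mxadj22 !phase_twist22 mxadj22 !rmorphM /= conjCK.
Qed.

Lemma psi_phase_twist (q : R) w A : psi q (phase_twist w A) = psi q A.
Proof. by rewrite [A]mx22_eta phase_twist22 !psi22. Qed.

(** * Automorphisms preserving [psi q] *)

Lemma real_unit_interval_neq (q : R) : 0 < q < 1 ->
  [/\ q%:C != 0, q%:C ^+ 2 != 1 & q%:C ^+ 4 != 1].
Proof.
case/andP=> q0 q1; have Q2 n : (0 < n)%N -> q%:C ^+ n != 1.
  by move=> n0; rewrite -rmorphXn fmorph_eq1 lt_eqF // exprn_ilt1 ?ltW // -lt0n.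
by split; rewrite ?Q2 // fmorph_eq0 gt_eqF.
Qed.

(** Both products see only the entry [A 1 0], in the lower diagonal corner on the left and in the
    upper one on the right; q^2 is the ratio of the two weights of [psi q]. *)
Lemma psi_commute (q : R) A : q != 0 ->
  psi q (A *m mx22 0 1 0 0) = (q ^+ 2)%:C * psi q (mx22 0 1 0 0 *m A).
Proof.
move=> q0; have Q0 : q%:C != 0.
  by rewrite fmorph_eq0.
rewrite [A]mx22_eta !mulmx22 !psi22 !fmorphV !rmorphXn /=; field; exact: Q0.
Qed.

(* E_01 spans an eigenspace of the modular automorphism of psi, so that a
   psi-preserving f must rescale it. *)
Lemma psi_automorphism_phase (q : R) (f : 'End('M[C]_2)) : 0 < q < 1 ->
  star_automorphism f -> (forall A, psi q (f A) = psi q A) ->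
  exists2 w, w * Num.conj w = 1 & f =1 phase_twist w.
Proof.
move=> hq [[g fK gK] fM fadj] fpsi.
have [Q0 Q2 Q4] := real_unit_interval_neq _ hq.
have q0 : q != 0 by case/andP: hq => /gt_eqF ->.
pose E01 : 'M[C]_2 := mx22 0 1 0 0; pose E10 : 'M[C]_2 := mx22 0 0 1 0.
(* Surjectivity of [f] transports the commutation relation of [E01] to [f E01], tested against every
   [B]. *)
have eig B : psi q (B *m f E01) = (q ^+ 2)%:C * psi q (f E01 *m B).
  by rewrite -[B]gK -!fM !fpsi psi_commute.
have [w Ew] : exists w, f E01 = mx22 0 w 0 0.
  move: eig; rewrite [f E01]mx22_eta.
  move: (f E01 0 0) (f E01 0 1) (f E01 1 0) (f E01 1 1) => a b c d eig.
  have K0 : (1 + q ^+ 2)%:C != 0 :> C.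
    rewrite fmorph_eq0.
    by rewrite gt_eqF // ltr_pwDl ?sqr_ge0.
  (* Up to nonzero factors, these three tests give a (1 - q^2) = 0, d (1 - q^2) = 0 and c (1 - q^4)
     = 0, so only [b] survives. *)
  have := eig (mx22 1 0 0 0); have := eig (mx22 0 0 0 1); have := eig (mx22 0 1 0 0).
  rewrite !mulmx22 !psi22 !(mulr0, mul0r, addr0, add0r, mulr1, mul1r).
  rewrite !fmorphV !rmorphXn /= => ec ed ea.
  exists b; congr mx22.
  - apply/eqP; have : (a * (1 - q%:C ^+ 2)) = 0.
      apply: (mulfI K0); apply: (mulfI (invr_neq0 (expf_neq0 2 Q0))).
      rewrite !mulr0; move: ea => /eqP; rewrite -subr_eq0 => /eqP <-; ring.
    by move/eqP; rewrite mulf_eq0 subr_eq0 [1 == _]eq_sym (negbTE Q2) orbF.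
  - apply/eqP; have : (c * (1 - q%:C ^+ 4)) = 0.
      apply: (mulfI K0); apply: (mulfI (invr_neq0 (expf_neq0 2 Q0))).
      by rewrite !mulr0; move: ec => /eqP; rewrite -subr_eq0 => /eqP <-; field.
    by move/eqP; rewrite mulf_eq0 subr_eq0 [1 == _]eq_sym (negbTE Q4) orbF.
  - apply/eqP; have : (d * (1 - q%:C ^+ 2)) = 0.
      apply: (mulfI K0).
      rewrite !mulr0; move: ed => /eqP; rewrite -subr_eq0 => /eqP <-; ring.
    by move/eqP; rewrite mulf_eq0 subr_eq0 [1 == _]eq_sym (negbTE Q2) orbF.
have Ew' : f E10 = mx22 0 0 (Num.conj w) 0.
  have := fadj E01; rewrite Ew -!/(mxadj _) !mxadj22 !rmorph0 rmorph1.
  by [].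
have E00w : f (mx22 1 0 0 0) = mx22 (w * Num.conj w) 0 0 0.
  have -> : mx22 1 0 0 0 = E01 *m E10 :> 'M[C]_2.
    by rewrite mulmx22 !(mulr0, mul0r, addr0, add0r, mulr1).
  by rewrite fM Ew Ew' mulmx22 !(mulr0, mul0r, addr0, add0r).
have E11w : f (mx22 0 0 0 1) = mx22 0 0 0 (w * Num.conj w).
  have -> : mx22 0 0 0 1 = E10 *m E01 :> 'M[C]_2.
    by rewrite mulmx22 !(mulr0, mul0r, addr0, add0r, mulr1).
  by rewrite fM Ew Ew' mulmx22 !(mulr0, mul0r, addr0, add0r) mulrC.
(* The image |w|^2 E_00 of an idempotent is idempotent, so |w|^2 is 0 or 1; injectivity of [f]
   excludes 0. *)
have ww : w * Num.conj w = 1.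
  have : f (mx22 1 0 0 0 *m mx22 1 0 0 0) = f (mx22 1 0 0 0).
    by rewrite mulmx22 !(mulr0, mul0r, addr0, add0r, mulr1).
  rewrite fM E00w mulmx22 => /mx22_inj[+ _ _ _]; rewrite mulr0 addr0.
  rewrite -[RHS]mulr1; apply: mulfI.
  apply/eqP => ww0; move: E00w; rewrite ww0.
  have -> : mx22 0 0 0 0 = f 0 by rewrite linear0 [RHS]mx22_eta !mxE.
  move/(can_inj fK); rewrite [RHS]mx22_eta !mxE => /mx22_inj[/eqP].
  by rewrite oner_eq0.
exists w => // A; rewrite [A]mx22_eta phase_twist22.
have -> : mx22 (A 0 0) (A 0 1) (A 1 0) (A 1 1) =
  A 0 0 *: mx22 1 0 0 0 + A 0 1 *: E01 + A 1 0 *: E10 + A 1 1 *: mx22 0 0 0 1.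
  by rewrite !scale_mx22 !add_mx22 !(mulr0, addr0, add0r, mulr1).
rewrite !linearD !linearZ /= E00w Ew Ew' E11w ww.
rewrite !scale_mx22 !add_mx22 !(mulr0, addr0, add0r, mulr1).
by congr mx22; exact: mulrC.
Qed.

(** * Isomorphism of lines in coordinates *)

Lemma vline_eqP {K : fieldType} {vT : vectType K} (u v : vT) :
  <[u]>%VS = <[v]>%VS <-> exists2 k : K, k != 0 & v = k *: u.
Proof.
split=> [e | [k k0 ->]]; last first.
  apply/eqP; rewrite eqEsubv -!memvE memvZ ?memv_line // andbT.
  by rewrite -{1}[u]scale1r -(mulVf k0) -scalerA memvZ ?memv_line.
have [v0|v0] := eqVneq v 0.
  have : u \in <[v]>%VS by rewrite -e memv_line.
  rewrite v0 => /vlineP[k ->].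
  by exists 1; rewrite ?oner_eq0 // !scaler0.
have : v \in <[u]>%VS by rewrite e memv_line.
case/vlineP => k vE; exists k => //.
by apply: contra_neq v0 => k0; rewrite vE k0 scale0r.
Qed.

(* [((s, t), (a, g))] stands for the matrix with off-diagonal entries [s], [t]
   whose coordinates along [sigma_0] and [sigma_3] are [a] and [g]. *)
Definition pauli_line (q : R) (x : (C * C) * (C * C)) : qgraph R :=
  <[mx22 (x.2.1 + (q ^- 2)%:C * x.2.2) x.1.1 x.1.2 (x.2.1 - x.2.2)]>%VS.

(** Here [w] comes from the automorphism and [k] from the choice of a spanning vector. The second
    pair describes the diagonal, on which [w] does not act. *)
Definition phase_equiv (x y : (C * C) * (C * C)) : Prop :=
  exists w k, [/\ w * Num.conj w = 1, k != 0, y.1.1 = k * (w * x.1.1),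
    y.1.2 = k * (Num.conj w * x.1.2) & y.2 = (k * x.2.1, k * x.2.2)].

(** The difference of the diagonal entries is (1 + q^-2) g, which determines [g] and then [a]. *)
Lemma pauli_mx_inj (q : R) (a s t g a' s' t' g' : C) : 0 < q < 1 ->
  mx22 (a + (q ^- 2)%:C * g) s t (a - g) =
  mx22 (a' + (q ^- 2)%:C * g') s' t' (a' - g') -> [/\ a = a', s = s', t = t' & g = g'].
Proof.
move=> hq /mx22_inj[e1 -> -> e2].
have Q1 : (1 + q ^- 2)%:C != 0 :> C.
  rewrite fmorph_eq0.
  by rewrite gt_eqF // ltr_pwDl ?invr_ge0 ?sqr_ge0.
have gg : g = g'.
  apply: (mulfI Q1); rewrite rmorphD rmorph1.
  transitivity (a + (q ^- 2)%:C * g - (a - g)); first by ring.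
  by rewrite e1 e2; ring.
by split=> //; apply: (addIr (- g)); rewrite e2 gg.
Qed.

Lemma qgraph_isoP (q : R) x y : 0 < q < 1 ->
  qgraph_iso q (pauli_line q x) (pauli_line q y) <-> phase_equiv x y.
Proof.
case: x => [[s t] [a g]]; case: y => [[s' t'] [a' g']] hq.
have lin w k : k *: phase_twist w (mx22 (a + (q ^- 2)%:C * g) s t (a - g)) =
    mx22 (k * a + (q ^- 2)%:C * (k * g)) (k * (w * s)) (k * (Num.conj w * t))
      (k * a - k * g).
  by rewrite phase_twist22 scale_mx22; congr mx22; ring.
split=> [[f [fstar fpsi]] | [w [k [w1 k0]]]]; rewrite /pauli_line /=.
  have [w w1 fE] := psi_automorphism_phase q f hq fstar fpsi.
  rewrite limg_line fE => /vline_eqP[k k0].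
  by rewrite lin => /(pauli_mx_inj _ _ _ _ _ _ _ _ _ hq)[-> -> -> ->]; exists w, k.
move=> -> -> [-> ->]; exists (linfun (phase_twist w)).
split; [exact: phase_twist_star | by move=> A; rewrite lfunE psi_phase_twist |].
by rewrite limg_line lfunE /=; apply/vline_eqP; exists k.
Qed.

(** This Euclidean form compares two normal forms of one graph directly; with reflexivity it also
    yields transitivity. *)
Lemma phase_equiv_common (x y z : (C * C) * (C * C)) : phase_equiv x y -> phase_equiv x z ->
  phase_equiv y z.
Proof.
case: x y z => [[s t] [a g]] [[s1 t1] [a1 g1]] [[s2 t2] [a2 g2]].
move=> [w [k [/= w1 k0 -> -> [-> ->]]]] [w' [k' [/= w1' k0' -> -> [-> ->]]]].
have cw : Num.conj (w' * Num.conj w) = Num.conj w' * w by rewrite rmorphM /= conjCK.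
exists (w' * Num.conj w), (k' / k); rewrite /= cw; split.
- transitivity ((w' * Num.conj w') * (w * Num.conj w)); first by ring.
  by rewrite w1 w1' mulr1.
- by rewrite mulf_neq0 ?invr_eq0.
- transitivity ((k' * (w' * s)) * (w * Num.conj w)); first by rewrite w1 mulr1.
  by field.
- transitivity ((k' * (Num.conj w' * t)) * (w * Num.conj w)); first by rewrite w1 mulr1.
  by field.
- by congr pair; field.
Qed.

(** * Coordinates of graphs with one edge *)

(** The off-diagonal entries of sigma_1 + i beta sigma_2 are 1 + beta and 1 - beta. *)
Definition edge_coord (p : one_edge_index R) : (C * C) * (C * C) :=
  match p with
  | Idx1B alpha => ((0, 0), (alpha, 1))
  | Idx1C alpha beta gamma => ((1 + beta%:C, 1 - beta%:C), (alpha, gamma))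
  end.

Lemma pauli_comb_cV4 (q : R) (x0 x1 x2 x3 : C) :
  pauli_comb q (cV4 x0 x1 x2 x3) =
  mx22 (x0 + (q ^- 2)%:C * x3) (x1 - 'i%C * x2) (x1 + 'i%C * x2) (x0 - x3).
Proof.
rewrite /pauli_comb !big_ord_recl big_ord0 /pauli /= mx22_id !mxE /= !scale_mx22 addr0.
rewrite !add_mx22 !(mulr1, mulr0, add0r, addr0, mulrN) (mulrC x2).
by rewrite (mulrC x3).
Qed.

Lemma G1A_line (q : R) : G1A q = pauli_line q ((0, 0), (1, 0)).
Proof.
rewrite /G1A /qgraph_of_pauli limg_line lfunE /= pauli_comb_cV4 /pauli_line /=.
by rewrite !(mulr0, addr0, subr0).
Qed.

Lemma one_edge_graph_line (q : R) p :
  one_edge_graph q p = pauli_line q (edge_coord p).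
Proof.
case: p => [a | a b c] /=; rewrite /G1B /G1C /qgraph_of_pauli limg_line lfunE /=;
  rewrite pauli_comb_cV4 /pauli_line /=.
  by rewrite !(mulr0, addr0, subr0).
by rewrite mulrA -expr2 sqr_i mulN1r opprK.
Qed.

Lemma one_edge_lineP (q : R) (S : qgraph R) : num_qedges S = 1%N ->
  exists2 x, S = pauli_line q x & x <> ((0, 0), (0, 0)).
Proof.
move=> S1; have S0 : vpick S != 0 by rewrite vpick0 -dimv_eq0 -/(num_qedges S) S1.
have SE : S = <[vpick S]>%VS.
  apply/eqP; rewrite eq_sym eqEdim dim_vline S0 -/(num_qedges S) S1 leqnn andbT.
  by rewrite -memvE memv_pick.
move: (vpick S) S0 SE => M M0 ->.
have Q1 : 1 + (q ^- 2)%:C != 0 :> C.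
  rewrite -(rmorph1 (real_complex R)) -rmorphD.
  rewrite fmorph_eq0.
  by rewrite gt_eqF // ltr_pwDl ?invr_ge0 ?sqr_ge0.
(* The coordinates are recovered from the diagonal a + q^-2 g, a - g. *)
pose g := (M 0 0 - M 1 1) / (1 + (q ^- 2)%:C).
have ME : M = mx22 (M 1 1 + g + (q ^- 2)%:C * g) (M 0 1) (M 1 0) (M 1 1 + g - g).
  rewrite [LHS]mx22_eta; congr mx22; last by rewrite addrK.
  have -> : M 0 0 = M 1 1 + g * (1 + (q ^- 2)%:C) by rewrite divfK // subrKC.
  by ring.
exists ((M 0 1, M 1 0), (M 1 1 + g, g)); first by rewrite /pauli_line -ME.
move=> [e01 e10 e g0]; move: M0; rewrite ME e01 e10 e g0 mulr0 addr0 subr0.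
by rewrite [mx22 _ _ _ _]mx22_eta; apply/negP/negPn/eqP; rewrite [RHS]mx22_eta !mxE.
Qed.

(** * The half-plane of arguments below pi *)

Lemma carg_lt_pi z : (carg z < pi) =
  [|| z == 0, 0 < complex.Im z | (complex.Im z == 0) && (0 < complex.Re z)].
Proof.
have p0 : 0 < pi :> R by exact: pi_gt0.
have [->|z0] := eqVneq z 0; first by rewrite /carg eqxx p0.
have n0 : 0 < Normc.normc z.
  rewrite lt_def; apply/andP; split; last by case: (z) => a b; exact: sqrtr_ge0.
  by apply: contra_neq z0 => /Normc.eq0_normc.
have /andP[] := carg_itv z; have := carg_polar z; move: (carg z) => t zE t0 t2.
have -> : complex.Im z = Normc.normc z * sin t.
  by rewrite {1}zE /= mul0r addr0.
have -> : complex.Re z = Normc.normc z * cos t.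
  by rewrite {1}zE /= mul0r subr0.
rewrite !pmulr_rgt0 // mulf_eq0 (gt_eqF n0) /=.
have [tpi|tpi|->] := ltgtP t pi; last first.
- by rewrite sinpi cospi ltxx eqxx ltr0N1.
(* Beyond pi the sine is negative, as sin t = - sin (t - pi). *)
- have : 0 < sin (t - pi).
    by rewrite sin_gt0_pi // subr_gt0 tpi ltrBlDr -mulr2n.
  rewrite -[t in RHS](subrK pi) sinDpi => s0.
  by rewrite oppr_gt0 oppr_eq0 (lt_gtF s0) (gt_eqF s0).
(* At t = 0 the sine vanishes and the condition on the real part takes over. *)
- move: t0; rewrite le_eqVlt => /orP[/eqP<-|t0]; last by rewrite sin_gt0_pi ?t0.
  by rewrite sin0 cos0 eqxx ltr01 orbT.
Qed.

(** With the next lemma, this makes the half-plane a fundamental domain for z -> -z, the residual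
    action when beta is in (-1, 1). *)
Lemma carg_lt_piVN z : carg z < pi \/ carg (- z) < pi.
Proof.
rewrite !carg_lt_pi oppr_eq0; case: z => x y; rewrite eq_complex /=.
rewrite !oppr_gt0 oppr_eq0.
by case: (ltgtP y 0) => [||_]; case: (ltgtP x 0) => //=; rewrite ?orbT; auto.
Qed.

Lemma carg_lt_piN_eq0 z : carg z < pi -> carg (- z) < pi -> z = 0.
Proof.
rewrite !carg_lt_pi oppr_eq0 => h1 h2; apply/eqP; move: h1 h2.
case: z => x y; rewrite eq_complex /= !oppr_gt0 oppr_eq0.
by case: (ltgtP y 0) => [||_]; case: (ltgtP x 0) => //=.
Qed.

(** * Uniqueness of the normal form *)

Lemma normc_conj_unit w : w * Num.conj w = 1 -> `|w| = 1.
Proof.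
move=> w1; apply/eqP; rewrite -(pexpr_eq1 (n := 2)) ?normr_ge0 //.
by rewrite normCK w1.
Qed.

Lemma phase_neq0 w : w * Num.conj w = 1 -> w != 0.
Proof. by move=> w1; apply/eqP => w0; move/eqP: w1; rewrite w0 mul0r eq_sym oner_eq0. Qed.

Lemma ge0_norm_inj (k a b : C) : `|k| = 1 -> 0 <= a -> 0 <= b -> b = k * a -> b = a.
Proof.
by move=> k1 a0 b0 e; rewrite -(ger0_norm b0) e normrM k1 mul1r ger0_norm.
Qed.

Lemma phase_equiv_inj p p' : one_edge_admissible p -> one_edge_admissible p' ->
  phase_equiv (edge_coord p) (edge_coord p') -> p = p'.
Proof.
(* The sum of these two entries is 2, so they never both vanish; this separates the families 1B and
   1C. *)
have noBC (b : R) : 1 + b%:C = 0 :> C -> 1 - b%:C = 0 :> C -> False.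
  move=> e1 e2; have : (1 + b%:C) + (1 - b%:C) = 0 :> C by rewrite e1 e2 addr0.
  by rewrite addrACA subrr addr0 => /eqP; rewrite (pnatr_eq0 _ 2).
case: p p' => [a | a b c] [a' | a' b' c'] adm adm' [w [k [/= w1 k0]]].
- by move=> _ _ [-> ek]; move: ek; rewrite mulr1 => <-; rewrite mul1r.
- by rewrite !mulr0 => e1 e2; case: (noBC b').
- have w0 := phase_neq0 _ w1.
  move/esym/eqP; rewrite !mulf_eq0 (negbTE k0) (negbTE w0) /= => /eqP e1.
  move/esym/eqP; rewrite !mulf_eq0 (negbTE k0) conjC_eq0 (negbTE w0) /= => /eqP e2.
  by case: (noBC b).
case: adm => /andP[bl bu] [h1 h2 h3 h4]; case: adm' => /andP[bl' bu'] [h1' h2' h3' h4'].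
move=> es et [ea ec].
have ge1D (x : R) : -1 <= x -> 0 <= 1 + x%:C :> C.
  by move=> x1; rewrite -[1](rmorph1 (real_complex R)) -rmorphD (lecR 0) -lerBlDl sub0r.
have ge1B (x : R) : x <= 1 -> 0 <= 1 - x%:C :> C.
  by move=> x1; rewrite -[1](rmorph1 (real_complex R)) -rmorphB (lecR 0) subr_ge0.
have wn := normc_conj_unit _ w1.
have ns : 1 + b'%:C = `|k| * (1 + b%:C).
  by rewrite -(ger0_norm (ge1D _ bl')) es !normrM wn mul1r (ger0_norm (ge1D _ bl)).
have nt : 1 - b'%:C = `|k| * (1 - b%:C).
  by rewrite -(ger0_norm (ge1B _ bu')) et !normrM norm_conjC wn mul1r (ger0_norm (ge1B _ bu)).
(* Adding [ns] and [nt] gives 2 = 2 |k|. *)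
have k1 : `|k| = 1.
  have : 2%:R * `|k| = 2%:R * 1 :> C.
    rewrite -[RHS](_ : (1 + b'%:C) + (1 - b'%:C) = _); last by ring.
    by rewrite ns nt; ring.
  by apply: mulfI; rewrite pnatr_eq0.
have bb : b = b'.
  apply: (@complexI R); apply: (addrI 1); move: ns; rewrite k1 mul1r; exact: esym.
subst b'; clear bl' bu' ns nt.
have [[b1 b2]|bpm] : (b != 1 /\ b != -1) \/ (b = 1 \/ b = -1).
  by case: (eqVneq b 1); case: (eqVneq b (-1)); auto.
- have bin : -1 < b < 1 by rewrite !lt_neqAle bl bu b1 eq_sym b2.
  (* Both off-diagonal entries are nonzero and preserved, so k w = k conj(w) = 1, whence k^2 = 1. *)
  have kw : k * w = 1.
    apply: (mulIf (x := 1 + b%:C)); last by rewrite -mulrA -es mul1r.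
    by rewrite gt_eqF // -[1](rmorph1 (real_complex R)) -rmorphD (ltcR 0) -ltrBlDl sub0r; case/andP: bin.
  have kw' : k * Num.conj w = 1.
    apply: (mulIf (x := 1 - b%:C)); last by rewrite -mulrA -et mul1r.
    by rewrite gt_eqF // -[1](rmorph1 (real_complex R)) -rmorphB (ltcR 0) subr_gt0; case/andP: bin.
  have : k ^+ 2 = 1.
    rewrite -[k ^+ 2]mulr1 -w1.
    transitivity ((k * w) * (k * Num.conj w)); first by ring.
    by rewrite kw kw' mulr1.
  move/eqP; rewrite sqrf_eq1 => /orP[]/eqP ke.
    by rewrite ea ec ke !mul1r.
  (* For k = -1, [a] and [- a] would both have argument below pi, which forces a = 0; the same then
     applies to [c]. *)
  rewrite ke !mulN1r in ea ec.
  have a0 : a = 0.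
    have [//|/eqP aN0] := eqVneq a 0; apply: carg_lt_piN_eq0.
      by case/andP: (h3 bin aN0).
    have a'N0 : a' <> 0 by rewrite ea => /eqP; rewrite oppr_eq0 => /eqP.
    by rewrite -ea; case/andP: (h3' bin a'N0).
  have a'0 : a' = 0 by rewrite ea a0 oppr0.
  have c0 : c = 0.
    apply: carg_lt_piN_eq0; first by case/andP: (h4 bin a0).
    by rewrite -ec; case/andP: (h4' bin a'0).
  by rewrite ec c0 a'0 a0 oppr0.
(* Here beta is 1 or -1 and [k] is a phase. It relates two nonnegative numbers, the alphas or, if
   these vanish, the gammas, which therefore agree. *)
have [a0|/eqP aN0] := eqVneq a 0.
  have a'0 : a' = 0 by rewrite ea a0 mulr0.
  by rewrite a0 a'0 (ge0_norm_inj k c c' k1 (h2 bpm a0) (h2' bpm a'0) ec).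
have a'N0 : a' <> 0.
  by rewrite ea => /eqP; rewrite mulf_eq0 (negbTE k0) /= => /eqP.
have aa : a' = a.
  exact: (ge0_norm_inj k a a' k1 (ltW (h1 bpm aN0)) (ltW (h1' bpm a'N0)) ea).
have ke : k = 1 by apply: (mulIf (x := a)); [exact/eqP | rewrite -ea aa mul1r].
by rewrite ec ke mul1r aa.
Qed.

(** * Existence of the normal form *)

Lemma phase_rotation z : exists u, u * Num.conj u = 1 /\ u * z = `|z|.
Proof.
have [->|z0] := eqVneq z 0.
  by exists 1; rewrite rmorph1 mulr1 mulr0 normr0.
have n0 : `|z| != 0 by rewrite normr_eq0.
exists (Num.conj z / `|z|); split.
  rewrite rmorphM /= fmorphV /= conj_normC conjCK.
  transitivity ((z * Num.conj z) / `|z| ^+ 2); first by field.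
  by rewrite -normCK divff // expf_neq0.
transitivity ((z * Num.conj z) / `|z|); first by field.
by rewrite -normCK expr2 mulfK.
Qed.

Lemma phase_equiv_refl x : phase_equiv x x.
Proof.
exists 1, 1; rewrite rmorph1 !mul1r; split=> //; first exact: oner_neq0.
by case: (x) => ? [].
Qed.

Lemma phase_equiv_trans (x y z : (C * C) * (C * C)) : phase_equiv x y -> phase_equiv y z ->
  phase_equiv x z.
Proof.
move=> xy yz; apply: (phase_equiv_common y) yz.
exact: phase_equiv_common xy (phase_equiv_refl x).
Qed.

Lemma norm_real_complex z : `|z| = (Normc.normc z)%:C.
Proof. by rewrite normc_def; case: z. Qed.

Lemma phase_equiv_edge s t a g : (s != 0) || (t != 0) ->
  exists alpha beta gamma, -1 <= beta <= 1 /\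
    phase_equiv ((s, t), (a, g)) (edge_coord (Idx1C alpha beta gamma)).
Proof.
move=> st0; have [u [u1 us]] := phase_rotation s.
have [v [v1 vt]] := phase_rotation t.
(* Rotating both entries to their moduli asks for m w = u and m conj(w) = v, hence w^2 = u
   conj(v). *)
pose w := sqrtC (u * Num.conj v); pose m := u * Num.conj w.
have w1 : w * Num.conj w = 1.
  rewrite -normCK -normrX sqrtCK normrM norm_conjC.
  by rewrite (normc_conj_unit _ u1) (normc_conj_unit _ v1) mulr1.
have mw : m * w = u by rewrite /m -mulrA (mulrC _ w) w1 mulr1.
have mw' : m * Num.conj w = v.
  rewrite /m -mulrA -expr2 -rmorphXn sqrtCK rmorphM /= conjCK.
  by rewrite mulrA u1 mul1r.
have m0 : m != 0.
  by apply: contraTneq (phase_neq0 _ u1) => m0; rewrite -mw m0 mul0r eqxx.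
clearbody m; set ns := Normc.normc s; set nt := Normc.normc t.
have nsE : `|s| = ns%:C by rewrite norm_real_complex.
have ntE : `|t| = nt%:C by rewrite norm_real_complex.
have ns0 : 0 <= ns by rewrite -lecR -nsE normr_ge0.
have nt0 : 0 <= nt by rewrite -lecR -ntE normr_ge0.
have n0 : 0 < ns + nt.
  rewrite -ltcR rmorphD /= -nsE -ntE.
  by case/orP: st0 => z0; [apply: ltr_wpDr | apply: ltr_wpDl]; rewrite ?normr_gt0.
have N0 : ns%:C + nt%:C != 0.
  by rewrite -rmorphD fmorph_eq0 gt_eqF.
(* The positive factor scales the sum of the off-diagonal entries to 2; beta is half their
   difference. *)
pose k := 2 / (ns%:C + nt%:C) * m.
exists (k * a), ((ns - nt) / (ns + nt)), (k * g); split.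
  rewrite ler_pdivlMr // ler_pdivrMr //; apply/andP; split; lra.
exists w, k; split=> //=.
- by rewrite !mulf_neq0 ?invr_eq0 ?pnatr_eq0.
- have -> : k * (w * s) = 2 / (ns%:C + nt%:C) * (m * w * s) by rewrite /k; ring.
  by rewrite mw us nsE fmorph_div rmorphB rmorphD /=; field.
- have -> : k * (Num.conj w * t) = 2 / (ns%:C + nt%:C) * (m * Num.conj w * t).
    by rewrite /k; ring.
  by rewrite mw' vt ntE fmorph_div rmorphB rmorphD /=; field.
Qed.

Lemma phase_equiv_admissible (beta : R) a g : -1 <= beta <= 1 ->
  exists2 p, one_edge_admissible p &
    phase_equiv (edge_coord (Idx1C a beta g)) (edge_coord p).
Proof.
move=> hb.
have [bpm|[b1 b2]] : (beta = 1 \/ beta = -1) \/ (beta <> 1 /\ beta <> -1).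
  by case: (eqVneq beta 1) => [|/eqP]; case: (eqVneq beta (-1)) => [|/eqP]; auto.
- have bin : ~~ (-1 < beta < 1) by case: bpm => ->; rewrite ltxx ?andbF.
  (* The coordinate that [J1C] constrains is rotated to its modulus. *)
  pose z := if a == 0 then g else a.
  have [u [u1 uz]] := phase_rotation z.
  have u0 := phase_neq0 _ u1.
  exists (Idx1C (u * a) beta (u * g)).
    split=> //; split; try by move=> h; move: bin; rewrite h.
      move=> _ /eqP; rewrite mulf_eq0 (negbTE u0) /= => a0.
      by move: uz; rewrite /z (negbTE a0) => ->; rewrite normr_gt0.
    move=> _ /eqP; rewrite mulf_eq0 (negbTE u0) /= => a0.
    by move: uz; rewrite /z a0 => ->.
  (* One off-diagonal entry is 0, so [w] only has to compensate [u] on the other: it is conj(u) for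
     beta = 1 and [u] for beta = -1. *)
  case: bpm => ->.
    exists (Num.conj u), u; rewrite /= conjCK mulrC; split=> //.
      by rewrite mulrA u1 mul1r.
    by rewrite rmorph1 subrr !mulr0.
  exists u, u; rewrite /=; split=> //.
    by rewrite rmorphN rmorph1 subrr !mulr0.
  by rewrite mulrA u1 mul1r.
have adm u : u = 1 \/ u = -1 -> carg (u * a) < pi :> R -> (a = 0 -> carg (u * g) < pi :> R) ->
    one_edge_admissible (Idx1C (u * a) beta (u * g)).
  move=> u1 ha hg; have u0 : u != 0.
    by case: u1 => ->; rewrite ?oppr_eq0 oner_eq0.
  split=> //; split; try by case.
    by move=> _ _; rewrite ha; case/andP: (carg_itv (u * a)) => ->.
  move=> _ /eqP; rewrite mulf_eq0 (negbTE u0) /= => /eqP a0.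
  by rewrite hg //; case/andP: (carg_itv (u * g)) => ->.
(* The sign is dictated by [a], or by [g] when a = 0. Taking w = k = u later leaves the off-diagonal
   entries fixed since u^2 = 1. *)
have [u u1 [ha hg]] : exists2 u, u = 1 \/ u = -1 &
    carg (u * a) < pi :> R /\ (a = 0 -> carg (u * g) < pi :> R).
  have [a0|/eqP aN0] := eqVneq a 0.
    case: (carg_lt_piVN g) => hg; [exists 1 | exists (-1)]; auto;
      by rewrite a0 mulr0 ?mul1r ?mulN1r carg_lt_pi eqxx.
  by case: (carg_lt_piVN a) => ha; [exists 1 | exists (-1)]; auto; rewrite ?mul1r ?mulN1r.
exists (Idx1C (u * a) beta (u * g)); first exact: adm.
exists u, u; case: u1 => -> /=.
  by rewrite rmorph1 !mul1r oner_eq0.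
by rewrite rmorphN rmorph1 !mulN1r !opprK oppr_eq0 oner_eq0.
Qed.

(** The hypothesis excludes exactly the multiples of the identity matrix. *)
Lemma phase_equiv_exists x : x.1 <> (0, 0) \/ x.2.2 <> 0 ->
  exists2 p, one_edge_admissible p & phase_equiv x (edge_coord p).
Proof.
case: x => [[s t] [a g]] /= h.
have [st0|] := boolP ((s != 0) || (t != 0)).
  have [al [be [ga [hb e]]]] := phase_equiv_edge s t a g st0.
  have [p pa pe] := phase_equiv_admissible be al ga hb.
  by exists p => //; apply: phase_equiv_trans e pe.
rewrite negb_or !negbK => /andP[/eqP s0 /eqP t0]; rewrite s0 t0 in h *.
have g0 : g != 0 by case: h => // /eqP.
(* On a diagonal line, k = 1/g normalises the coefficient of sigma_3 to 1. *)
exists (Idx1B (g^-1 * a)) => //; exists 1, g^-1.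
by rewrite /= rmorph1 !mulr0 mulVf // mulr1 invr_eq0.
Qed.

End OneEdge.

(** * Classification of graphs with one edge *)

Theorem theorem7p2 (R : realType) (q : R) (hq : 0 < q < 1) :
  G1A q = <[1%:M]>%VS /\
  forall S : qgraph R, num_qedges S = 1%N ->
    (S = G1A q /\
     forall p : one_edge_index R,
       one_edge_admissible p -> ~ qgraph_iso q S (one_edge_graph q p)) \/
    (S <> G1A q /\
     exists! p : one_edge_index R,
       one_edge_admissible p /\ qgraph_iso q S (one_edge_graph q p)).
Proof.
split.
  by rewrite G1A_line /pauli_line /= mulr0 addr0 subr0 -mx22_id.
move=> S /(one_edge_lineP q)[[[s t] [a g]] -> x0].
have [e|h] : (s, t, g) = (0, 0, 0) \/ ((s, t) <> (0, 0) \/ g <> 0).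
  have [[-> ->]|] := eqVneq (s, t) (0, 0); last by move/eqP; auto.
  by have [->|/eqP] := eqVneq g 0; auto.
- move: e x0 => [-> -> ->] x0; left.
  have a0 : a != 0 by apply/eqP => a0; apply: x0; rewrite a0.
  have -> : pauli_line q ((0, 0), (a, 0)) = G1A q.
    rewrite G1A_line /pauli_line /= mulr0 !addr0 !subr0; apply/vline_eqP.
    by exists a^-1; rewrite ?invr_eq0 // scale_mx22 !mulr0 mulVf.
  split=> // p _; rewrite G1A_line one_edge_graph_line => /(qgraph_isoP _ _ _ hq).
  case=> w [k [/= _ _]]; rewrite !mulr0; case: p => [b _ _ [_] | b c d] /=.
    by move/eqP; rewrite oner_eq0.
  move=> e1 e2 _; have : (1 + c%:C) + (1 - c%:C) = 0 :> R[i] by rewrite e1 e2 addr0.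
  by rewrite addrACA subrr addr0 => /eqP; rewrite (pnatr_eq0 _ 2).
right; split.
  (* Reflexivity, rewritten along the supposed equality with [G1A q], turns it into an equivalence
     with ((0, 0), (1, 0)), which forces s = t = g = 0. *)
  move=> SE; have := phase_equiv_refl ((s, t), (a, g)).
  move/(qgraph_isoP _ _ _ hq); rewrite {2}SE G1A_line => /(qgraph_isoP _ _ _ hq).
  case=> w [k [/phase_neq0 w0 k0 /= /esym/eqP + /esym/eqP + [_ /esym/eqP]]].
  rewrite !mulf_eq0 conjC_eq0 (negbTE w0) (negbTE k0) /=.
  by move=> /eqP s0 /eqP t0 /eqP g0; case: h => //; rewrite s0 t0.
have [p pa pe] := phase_equiv_exists ((s, t), (a, g)) h.
exists p; split.
  by split=> //; rewrite one_edge_graph_line; apply/qgraph_isoP.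
move=> p' [p'a]; rewrite one_edge_graph_line => /(qgraph_isoP _ _ _ hq) pe'.
by apply: phase_equiv_inj => //; apply: phase_equiv_common pe pe'.
Qed.
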